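(* Let $r\ge2$. There exists $d_2=d_2(r)$ such that, if $d>d_2$ and $G$ is an $r$-uniform $r$-partite hypergraph of order $rn$ (with $n$ vertices in each class) having property $I(r,n,d)$ (where $1\le d\le n^{r-1}$), then $$\chi_l(G)>g(r,\alpha)\log_r d-6r\log\log d,$$ where $\alpha=\log_n d$.
   Context: Setting: vertex classes $V_1,\dots,V_r$, disjoint, each of size $n$; each edge has one vertex in each class. For $X\subseteq V(G)$, $X_i=X\cap V_i$ and $i_X=\min\{i:|X_i|=\max_j|X_j|\}$. $X$ is independent if it contains no edge. $G$ has property $I(r,n,d)$ if every independent $X$ satisfies $\prod_{i\ne i_X}|X_i|<\frac{n^{r-1}}{d}\log^2 d$ ($\log$ natural). $\chi_l(G)$ is the list chromatic number (least $k$ such that for any lists $|L(v)|\ge k$ one can pick $c(v)\in L(v)$ with no monochromatic edge). The function $g$: For a total order $<$ on $[m]$ and $k\in[m]$, ${\rm rpos}_<(k)=\frac1m|\{j\in[m]:j\le k\text{ in }<\}|$. An $(r,m)$-preference order is $P=(<_1,\dots,<_r)$, total orders on $[m]$; $x\in P$ means $x=({\rm rpos}_{<_1}(k),\dots,{\rm rpos}_{<_r}(k))$ for some $k$. For $x\in[0,1]^r$, $i_x=\min\{i:x_i=\max_jx_j\}$. For $0\le\theta\le1/r$: $f_P(\theta)=\max\{\prod_{i\ne i_x}x_i:x\in P,\ x\in[\theta,1]^r\}$, $f(r,\theta,m)=\min_Pf_P(\theta)$, $f(r,\theta)=\inf_mf(r,\theta,m)$. For $0<\alpha\le r-1$, $\beta(\alpha)=\sup\{\theta\in[0,1/r]:\theta^\alpha\le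 f(r,\theta)\}$ (the solution of $\theta^\alpha=f(r,\theta)$) and $g(r,\alpha)=-1/\log_rf(r,\beta(\alpha))$; $g(r,0)$ is the constant value of $g(r,\alpha)$ on $(0,1]$. *)

(* Defs.v *)
From HB Require Import structures.
From mathcomp Require Import all_boot all_order all_algebra.
From mathcomp Require Import all_classical all_reals all_analysis.
From mathcomp Require wochoice.

Set Implicit Arguments.
Unset Strict Implicit.
Unset Printing Implicit Defensive.

Import Order.TTheory GRing.Theory Num.Theory.
Local Open Scope classical_set_scope.
Local Open Scope ring_scope.

Definition logb {R : realType} (b x : R) : R := ln x / ln b.

(** [is_first_max x i]: i is the least index at which x is maximal, i.e. the
    index i_x (for 0 < r there is exactly one such index). *)
Definition is_first_max {R : realType} {r : nat} (x : 'I_r -> R) (i : 'I_r) :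
    bool :=
  [forall j, x j <= x i] && [forall j : 'I_r, (j < i)%N ==> (x j < x i)].

Definition prod_but_first_max {R : realType} {r : nat} (x : 'I_r -> R) : R :=
  \prod_(i | ~~ is_first_max x i) x i.

Record hypergraph (r n : nat) (T : finType) := Hypergraph {
  vclass : T -> 'I_r;
  edges : {set {set T}};
  card_vclass : forall i, #|[set v | vclass v == i]%SET| = n;
  edge_vclass : forall e, e \in edges ->
    forall i, #|[set v in e | vclass v == i]%SET| = 1%N }.

Section Hypergraphs.
Variables (r n : nat) (T : finType) (G : hypergraph r n T).

Definition class_part (X : {set T}) (i : 'I_r) : {set T} :=
  [set v in X | vclass G v == i]%SET.

Definition independent (X : {set T}) : Prop :=
  forall e, e \in edges G -> ~~ (e \subset X).

Definition propertyI {R : realType} (d : R) : Prop :=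
  forall X : {set T}, independent X ->
    prod_but_first_max (fun i => #|class_part X i|%:R : R)
      < n%:R ^+ r.-1 / d * ln d ^+ 2.

Definition monochromatic (C : Type) (c : T -> C) (e : {set T}) : Prop :=
  exists a, forall v, v \in e -> c v = a.

(** Lists with at least k colours may be shrunk to finite ones, so finite
    palettes lose nothing. *)
Definition choosable (k : nat) : Prop :=
  forall (C : finType) (L : T -> {set C}), (forall v, (k <= #|L v|)%N) ->
    exists c : T -> C, (forall v, c v \in L v) /\
      (forall e, e \in edges G -> ~ monochromatic c e).

(** The default value 0 is never used when r >= 2, see
    [list_chromatic_numberP]. *)
Definition list_chromatic_number : nat :=
  xget 0%N [set k | choosable k /\ forall j, choosable j -> (k <= j)%N].

Lemma choosable_card : (2 <= r)%N -> choosable #|T|.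
Proof.
move=> r2 C L hL.
have base (v : T) : {a | a \in L v}.
  apply: sigW; apply/set0Pn; rewrite -card_gt0.
  by apply: leq_trans (hL v); apply/card_gt0P; exists v.
have ext (s : seq T) : uniq s -> exists c : T -> C,
    (forall v, c v \in L v) /\ {in s &, injective c}.
  elim: s => [_|w s IH /= /andP[ws us]].
    by exists (fun v => sval (base v)); split=> // v; case: (base v).
  have [c [cL ci]] := IH us.
  have /subsetPn[a aL ac] : ~~ (L w \subset map c s).
    apply/negP => /subset_leq_card /(leq_trans (hL w)).
    apply/negP; rewrite -ltnNge (leq_ltn_trans (card_size _)) // size_map.
    by have := max_card [in w :: s]; rewrite (card_uniqP _) //= ws.
  have ca u : u \in s -> c u <> a.
    by move=> us' E; move/negP: ac; apply; rewrite -E map_f.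
  exists (fun v => if v == w then a else c v); split.
    by move=> v; case: eqP => [->|].
  move=> u v; rewrite !inE.
  case: (eqVneq u w) => [->|_] /=; case: (eqVneq v w) => [->|_] //=.
  - by move=> _ /ca + E; rewrite -E.
  - by move=> /ca.
  - exact: ci.
have [c [cL ci]] := ext (enum T) (enum_uniq T).
exists c; split=> // e eG [a ha].
pose i0 := Ordinal (ltnW r2); pose i1 := Ordinal r2.
have /eqP/cards1P[u Eu] := edge_vclass eG i0.
have /eqP/cards1P[v Ev] := edge_vclass eG i1.
have : u \in [set u]%SET by rewrite inE.
rewrite -Eu inE => /andP[ue /eqP ui].
have : v \in [set v]%SET by rewrite inE.
rewrite -Ev inE => /andP[ve /eqP vi].
have uv : u = v by apply: ci; rewrite ?mem_enum // !ha.
by have := congr1 val vi; rewrite -uv ui.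
Qed.

Lemma list_chromatic_numberP : (2 <= r)%N ->
  choosable list_chromatic_number /\
  forall j, choosable j -> (list_chromatic_number <= j)%N.
Proof.
move=> r2; apply: (@xgetPex _ 0%N
  [set k | choosable k /\ forall j, choosable j -> (k <= j)%N]).
have ex : exists k, `[< choosable k >].
  by exists #|T|; apply/asboolP/choosable_card.
exists (ex_minn ex); case: ex_minnP => k /asboolP ck mk.
by split=> // j /asboolP/mk.
Qed.

End Hypergraphs.

Section PreferenceOrders.
Variable R : realType.
Implicit Types (r m : nat) (theta alpha : R).

(** The relations [P i] are the non-strict versions of the orders. *)
Definition preference_order r m (P : 'I_r -> rel 'I_m) : Prop :=
  forall i, wochoice.total_order (P i).

Definition rpos m (le : rel 'I_m) (k : 'I_m) : R :=
  #|[set j | le j k]%SET|%:R / m%:R.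

Definition pref_point r m (P : 'I_r -> rel 'I_m) (k : 'I_m) : 'I_r -> R :=
  fun i => rpos (P i) k.

(** All points of P have coordinates in ]0, 1], so membership in
    [theta, 1]^r only concerns the lower bound; the upper one is kept to follow
    the definition.  When 0 < m and theta <= 1/r some point qualifies, and all
    products are positive, so the default value 0 of the maximum is harmless. *)
Definition f_pref r m (P : 'I_r -> rel 'I_m) theta : R :=
  \big[Num.max/0]_(k < m | [forall i, theta <= pref_point P k i <= 1])
    prod_but_first_max (pref_point P k).

(** There are finitely many preference orders, so this infimum is a minimum. *)
Definition f_level r theta m : R :=
  inf [set f_pref P theta | P in [set P : 'I_r -> rel 'I_m | preference_order P]].

Definition f_inf r theta : R :=
  inf [set f_level r theta m | m in [set m | (0 < m)%N]].

Definition beta r alpha : R :=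
  sup [set theta | [/\ 0 <= theta, theta <= r%:R^-1
                     & theta `^ alpha <= f_inf r theta]].

Definition g_pos r alpha : R := - 1 / logb r%:R (f_inf r (beta r alpha)).

(** g r 0 is the constant value taken on ]0, 1], read off at 1. *)
Definition g r alpha : R := if alpha == 0 then g_pos r 1 else g_pos r alpha.

End PreferenceOrders.

(* Main.v *)
Require Import Defs.
From mathcomp Require Import all_boot all_order all_algebra.
From mathcomp Require Import all_classical all_reals all_analysis.
From mathcomp Require Import lra zify.
From mathcomp Require wochoice.
Import Order.TTheory GRing.Theory Num.Theory.
Local Open Scope ring_scope.

(** Give the vertices independent uniform random [k]-subsets of a palette of [m],
    about [log^3 d], colours.  With positive probability, for every class [V_i] and
    every set of [x m] colours with [x >= t], about [x^k n] vertices of [V_i] have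
    their list inside that set.  Given a colouring, order the palette in class [i]
    by the sizes of the colour classes inside [V_i].  Some colour has all its
    relative positions [x_i] at least [t] and product at least [f(r,t)], and
    its colour class has about [x_i^k n / m] vertices or more in [V_i].  So the
    colour class, which is independent, has product at least about
    [(n/m)^(r-1) f(r,t)^k], contradicting property I when [k] is too small.

    The union bound needs [n t^k] to exceed [m], so [t^max(alpha,1)] must not be
    less than [f(r,beta(alpha))].  For [alpha >= 1] take [t = beta(alpha)], using
    that [f(r,.)] does not jump down immediately to the right of a point below
    [1/r].  For [alpha < 1] take [t = f(r,0)], using [f(r,f(r,0)) = f(r,0)]. *)

(** * Products and weighted preference orders *)

Section ProductButMax.
Context {R : realType} {r : nat}.
Implicit Types x y : 'I_r -> R.

Lemma is_first_max_exists x : (0 < r)%N -> exists i, is_first_max x i.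
Proof.
move=> r0; pose p := fun i : 'I_r => [forall j, x j <= x i].
have [i0 pi0] : exists i0, p i0.
  have [i _ /(_ _ isT) ip] := @Order.TotalTheory.arg_maxP _ _ _ (Ordinal r0) xpredT x isT.
  by exists i; apply/forallP => j; exact: ip.
have [i pi mi] := arg_minnP (fun i : 'I_r => i : nat) pi0.
exists i; rewrite /is_first_max; apply/andP; split; first exact: pi.
apply/forallP => j; apply/implyP => ji; rewrite ltNge; apply/negP => xij.
have : p j by apply/forallP => l; apply: le_trans xij; move/forallP: pi; exact.
by move=> /mi; rewrite leqNgt ji.
Qed.

Lemma is_first_max_uniq x i j : is_first_max x i -> is_first_max x j -> i = j.
Proof.
move=> /andP[/forallP mi /forallP fi] /andP[/forallP mj /forallP fj].
case: (ltngtP i j) => [ij|ji|/ord_inj//].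
  by have := fj i; rewrite ij /= ltNge mi.
by have := fi j; rewrite ji /= ltNge mj.
Qed.

Lemma prod_but_first_maxE x i :
  is_first_max x i -> prod_but_first_max x = \prod_(j | j != i) x j.
Proof.
move=> fi; apply: eq_bigl => j; congr (~~ _); apply/idP/eqP => [fj|->//].
exact: is_first_max_uniq fj fi.
Qed.

Lemma prod_but_first_max_ex x : (0 < r)%N ->
  exists i, prod_but_first_max x = \prod_(j | j != i) x j.
Proof.
by move=> /(is_first_max_exists x)[i fi]; exists i; exact: prod_but_first_maxE.
Qed.

(** Leaving out a largest coordinate minimises the product, so for nonnegative [x] the quantity
    [prod_but_first_max x] is the least of the products that omit one index. *)
Lemma prod_but_first_max_le x i : (forall j, 0 <= x j) ->
  prod_but_first_max x <= \prod_(j | j != i) x j.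
Proof.
move=> x0; have r0 : (0 < r)%N by apply: leq_ltn_trans (ltn_ord i).
have [i0 fi0] := is_first_max_exists x r0; rewrite (prod_but_first_maxE x i0 fi0).
have [->//|ne] := eqVneq i0 i.
rewrite (bigD1 i) 1?eq_sym//= [leRHS](bigD1 i0)//=.
rewrite (eq_bigl (fun j => (j != i) && (j != i0))); last by move=> j; rewrite andbC.
apply: ler_wpM2r; first by apply: prodr_ge0.
by case/andP: fi0 => /forallP.
Qed.

Lemma ler_prod_but_first_max x y : (0 < r)%N -> (forall j, 0 <= x j <= y j) ->
  prod_but_first_max x <= prod_but_first_max y.
Proof.
move=> r0 xy; have [i ->] := prod_but_first_max_ex y r0.
have x0 j : 0 <= x j by case/andP: (xy j).
by apply: le_trans (prod_but_first_max_le x i x0) _; apply: ler_prod.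
Qed.

Lemma card_neq_ord (i : 'I_r) : #|[pred j : 'I_r | j != i]| = r.-1.
Proof. by rewrite cardC1 card_ord. Qed.

Lemma prod_but_first_maxZ (c : R) x : (0 < r)%N ->
  0 <= c -> (forall j, 0 <= x j) ->
  prod_but_first_max (fun j => c * x j) = c ^+ r.-1 * prod_but_first_max x.
Proof.
move=> r0 c0 x0; apply/eqP; rewrite eq_le; apply/andP; split.
  have [i ->] := prod_but_first_max_ex x r0.
  rewrite -(card_neq_ord i) -prodr_const -big_split/=.
  by apply: prod_but_first_max_le => j; apply: mulr_ge0.
have [i ->] := prod_but_first_max_ex (fun j => c * x j) r0.
rewrite big_split/= prodr_const card_neq_ord.
by apply: ler_wpM2l; [exact: exprn_ge0|exact: prod_but_first_max_le].
Qed.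

(** As [r >= 2], some index other than [i] can be omitted; the factors beside [x i] are at most
    1. *)
Lemma prod_but_first_max_le_coord x i : (2 <= r)%N ->
  (forall j, 0 <= x j <= 1) -> prod_but_first_max x <= x i.
Proof.
move=> r2 x01.
have [i' ne] : exists i', i != i' :> 'I_r.
  have [->|ne] := eqVneq i (Ordinal (ltnW r2)); first by exists (Ordinal r2).
  by exists (Ordinal (ltnW r2)).
have x0 j : 0 <= x j by case/andP: (x01 j).
apply: le_trans (prod_but_first_max_le x i' x0) _.
rewrite (bigD1 i)//= ler_piMr//.
by apply: prodr_ile1.
Qed.

Lemma prod_but_first_max_ge_expr x (t : R) : (0 < r)%N -> 0 <= t ->
  (forall j, t <= x j) -> t ^+ r.-1 <= prod_but_first_max x.
Proof.
move=> r0 t0 tx; have [i ->] := prod_but_first_max_ex x r0.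
rewrite -(card_neq_ord i) -prodr_const; apply: ler_prod => j _.
by rewrite t0 tx.
Qed.

End ProductButMax.

Section WeightedOrders.
Context {R : realType} {r : nat}.
Implicit Types (K : finType) (t v : R).

(** Relative position of [k] when each [j] stands for [w j] copies; ties are
    counted against [k], so this is the position of the last copy of the last
    element tied with [k]. *)
Definition wpos {K} (le : rel K) (w : K -> nat) (k : K) : R :=
  (\sum_(j | le j k) w j)%:R / (\sum_j w j)%:R.

Lemma wpos_itv K (le : rel K) w k : 0 <= wpos le w k <= 1.
Proof.
rewrite /wpos divr_ge0//=.
have [->|W0] := posnP (\sum_j w j)%N; first by rewrite invr0 mulr0.
rewrite ler_pdivrMr ?ltr0n// mul1r ler_nat.
by rewrite [leqRHS](bigID (fun j => le j k))/= leq_addr.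
Qed.

Lemma rpos_wpos m (le : rel 'I_m) k : rpos R le k = wpos le (fun=> 1%N) k.
Proof.
by rewrite /rpos /wpos !sum1_card card_ord; congr (_%:R / _); apply: eq_card => j; rewrite inE.
Qed.

Lemma rpos_itv m (le : rel 'I_m) k : 0 <= rpos R le k <= 1.
Proof. by rewrite rpos_wpos wpos_itv. Qed.

(** Each [k] is replaced by [w k] copies, and ties are broken by the enumeration of the copies.
    Since [wpos] counts all tied copies, breaking ties can only lower a position. *)
Lemma weighted_preference_order K (le : 'I_r -> rel K) (w : K -> nat) :
  (forall i, transitive (le i)) -> (forall i, total (le i)) ->
  exists m (P : 'I_r -> rel 'I_m) (origin : 'I_m -> K),
    [/\ m = (\sum_j w j)%N, preference_order P,
     forall a, (0 < w (origin a))%N &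
     forall i a, rpos R (P i) a <= wpos (le i) w (origin a)].
Proof.
move=> tr tt; pose C : finType := {k : K & 'I_(w k)}.
have cardC (Q : pred K) : #|[set x : C | Q (tag x)]%SET| = (\sum_(k | Q k) w k)%N.
  rewrite -sum1_card (eq_bigl (fun x : C => Q (tag x) && true)).
    rewrite -(@sig_big_dep _ _ _ _ (fun k => 'I_(w k)) Q (fun _ _ => true) (fun _ _ => 1%N)).
    by apply: eq_bigr => k _; rewrite sum1_card card_ord.
  by move=> x; rewrite inE andbT.
pose o (a : 'I_#|C|) := tag (enum_val a).
pose P i (a b : 'I_#|C|) := le i (o a) (o b) && (le i (o b) (o a) ==> (a <= b)%N).
have cC : #|C| = (\sum_j w j)%N by rewrite -(cardC xpredT) cardsT.
exists #|C|, P, o; split => //.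
- move=> i; split; last first.
    move=> a b; rewrite /P; have := tt i (o a) (o b).
    by case: (le i (o a)); case: (le i (o b)) => //= _; exact: leq_total.
  split; last first.
    move=> a b /andP[/andP[lab /implyP ab] /andP[lba /implyP ba]].
    by apply/ord_inj/eqP; rewrite eqn_leq ab ?ba.
  split; first by move=> a; rewrite /P leqnn implybT andbT; have := tt i (o a) (o a); rewrite orbb.
  move=> b a c /andP[lab /implyP ab] /andP[lbc /implyP bc]; apply/andP; split.
    exact: tr lab lbc.
  apply/implyP => lca; apply: leq_trans (ab _) (bc _).
    exact: tr lbc lca.
  exact: tr lca lab.
- by move=> a; rewrite /o; case: (enum_val a) => k [j /=]; exact: leq_ltn_trans.
- move=> i a; rewrite /rpos /wpos -cC ler_wpM2r ?invr_ge0// ler_nat.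
  rewrite -cardC -(card_imset _ (@enum_val_inj _ C)); apply: subset_leq_card.
  by apply/fintype.subsetP => _ /imsetP[b + ->]; rewrite !inE => /andP[].
Qed.

Lemma f_pref_ge0 m (P : 'I_r -> rel 'I_m) t : 0 <= f_pref P t.
Proof. by rewrite /f_pref; apply: bigmax_ge_id. Qed.

(** The condition [0 < v] accounts for the default value of the maximum. *)
Lemma f_pref_lt m (P : 'I_r -> rel 'I_m) t v :
  f_pref P t < v <-> 0 < v /\ forall k,
    (forall i, t <= rpos R (P i) k) -> prod_but_first_max (pref_point R P k) < v.
Proof.
have cond k : [forall i, t <= pref_point R P k i <= 1]
    <-> (forall i, t <= rpos R (P i) k).
  split=> [/forallP h i|h]; first by case/andP: (h i).
  by apply/forallP => i; rewrite h; have /andP[_ ->] := rpos_itv m (P i) k.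
rewrite /f_pref; split=> [/bigmax_ltP[v0 h]|[v0 h]]; first by split=> // k /cond/h.
by apply/bigmax_ltP; split=> // k /cond/h.
Qed.

Lemma preference_order_leq m :
  preference_order (fun _ : 'I_r => (fun a b : 'I_m => (a <= b)%N)).
Proof.
move=> i; split; last by move=> a b; exact: leq_total.
split; last by move=> a b; rewrite -eqn_leq => /eqP/ord_inj.
by split; [move=> a; exact: leqnn|move=> b a c; exact: leq_trans].
Qed.

Lemma f_level_le m (P : 'I_r -> rel 'I_m) t :
  preference_order P -> f_level r t m <= f_pref P t.
Proof.
move=> hP; apply: ge_inf; last by exists P.
by exists 0 => _ [Q _ <-]; exact: f_pref_ge0.
Qed.

Lemma f_level_ge0 m t : 0 <= f_level r t m :> R.
Proof.
apply: lb_le_inf; last by move=> _ [Q _ <-]; exact: f_pref_ge0.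
by exists (f_pref (fun _ : 'I_r => (fun a b : 'I_m => (a <= b)%N)) t); eexists;
  [exact: preference_order_leq|].
Qed.

Lemma f_inf_le m (P : 'I_r -> rel 'I_m) t :
  (0 < m)%N -> preference_order P -> f_inf r t <= f_pref P t.
Proof.
move=> m0 hP; apply: le_trans (f_level_le m P t hP).
apply: ge_inf; last by exists m.
by exists 0 => _ [q _ <-]; exact: f_level_ge0.
Qed.

Lemma f_inf_lt t v : f_inf r t < v ->
  exists m (P : 'I_r -> rel 'I_m), [/\ (0 < m)%N, preference_order P & f_pref P t < v].
Proof.
move=> /inf_lt[]; first by exists (f_level r t 1); exists 1%N.
move=> _ [m m0 <-] /inf_lt[].
  by exists (f_pref (fun _ : 'I_r => (fun a b : 'I_m => (a <= b)%N)) t); eexists;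
    [exact: preference_order_leq|].
by move=> _ [P hP <-] ?; exists m, P.
Qed.

(** Witnesses may have ties and weights: breaking ties lowers positions, which makes the threshold
    harder to reach and the products smaller. *)
Lemma f_inf_lt_weighted K (le : 'I_r -> rel K) (w : K -> nat) t v : (0 < r)%N ->
  (forall i, transitive (le i)) -> (forall i, total (le i)) ->
  (0 < \sum_j w j)%N -> 0 < v ->
  (forall k, (0 < w k)%N -> (forall i, t <= wpos (le i) w k) ->
    prod_but_first_max (fun i => wpos (le i) w k) < v) ->
  f_inf r t < v.
Proof.
move=> r0 tr tt W0 v0 h.
have [m [P [ o [mE hP wo Po]]]] := weighted_preference_order K le w tr tt.
apply: le_lt_trans (f_inf_le m P t _ hP) _; first by rewrite mE.
apply/f_pref_lt; split=> // a ta.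
apply: le_lt_trans (h (o a) (wo a) _); last by move=> i; exact: le_trans (ta i) _.
apply: ler_prod_but_first_max => // i; rewrite Po andbT.
by have /andP[] := rpos_itv m (P i) a.
Qed.

(** Replacing every colour by [N] consecutive copies does not increase [f_pref]. *)
Lemma f_inf_lt_large t v N : (0 < r)%N -> (0 < N)%N -> f_inf r t < v ->
  exists m (P : 'I_r -> rel 'I_m), [/\ (N <= m)%N, preference_order P & f_pref P t < v].
Proof.
move=> r0 N0 /f_inf_lt[m [P [m0 hP /f_pref_lt[v0 h]]]].
have [M [Q [ o [ME hQ _ Qo]]]] := weighted_preference_order _ P (fun=> N)
  (fun i => (hP i).1.1.2) (fun i => (hP i).2).
have {}Qo i a : rpos R (Q i) a <= rpos R (P i) (o a).
  apply: le_trans (Qo i a) _; rewrite rpos_wpos /wpos !sum_nat_const !muln1 !natrM.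
  rewrite -mulf_div divff ?mulr1// pnatr_eq0; lia.
exists M, Q; split => //; first by rewrite ME sum_nat_const card_ord; nia.
apply/f_pref_lt; split=> // a ta.
apply: le_lt_trans (h (o a) _); last by move=> i; exact: le_trans (ta i) _.
apply: ler_prod_but_first_max => // i; rewrite /pref_point Qo andbT.
by have /andP[] := rpos_itv M (Q i) a.
Qed.

Lemma f_inf_ge0 t : 0 <= f_inf r t :> R.
Proof.
apply: lb_le_inf; last by move=> _ [q _ <-]; exact: f_level_ge0.
by exists (f_level r t 1); exists 1%N.
Qed.

Lemma f_inf_anti t t' : t <= t' -> f_inf r t' <= f_inf r t :> R.
Proof.
move=> tt'; rewrite leNgt; apply/negP => /f_inf_lt[m [P [m0 hP /f_pref_lt[v0 h]]]].
have : f_pref P t' < f_inf r t'.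
  by apply/f_pref_lt; split=> // k tk; apply: h => i; exact: le_trans (tk i).
by rewrite ltNge f_inf_le.
Qed.

End WeightedOrders.

(** * Regularity of [f_inf] *)

Section TotalOrderRank.
Variables (m : nat) (le : rel 'I_m).
Hypothesis le_total_order : wochoice.total_order le.

Let rank k := #|[set j | le j k]%SET|.
Let le_refl := le_total_order.1.1.1.
Let le_trans := le_total_order.1.1.2.
Let le_anti := le_total_order.1.2.
Let le_total := le_total_order.2.

Lemma leq_rank j k : (rank j <= rank k)%N = le j k.
Proof.
have rank_le a b : le a b -> (rank a <= rank b)%N.
  move=> ab; apply/subset_leq_card/fintype.subsetP => l; rewrite !inE => la.
  exact: le_trans la ab.
apply/idP/idP => [jk|/rank_le//].
have [//|kj] := orP (le_total j k).
(* The lower set of [k] lies in that of [j] and is at least as large, so they coincide and contain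
   [j]. *)
have : [set l | le l k]%SET = [set l | le l j]%SET.
  apply/eqP; rewrite eqEcard jk andbT; apply/fintype.subsetP => l; rewrite !inE => lk.
  exact: le_trans lk kj.
by move=> /setP/(_ j); rewrite !inE le_refl.
Qed.

(** Distinct elements have distinct ranks between 1 and [m], so [rank - 1] permutes ['I_m]. *)
Lemma card_rank_le q : (q <= m)%N -> #|[set k | (rank k <= q)%N]%SET| = q.
Proof.
move=> qm.
have rank_gt0 k : (0 < rank k)%N by apply/card_gt0P; exists k; rewrite inE le_refl.
have rank_lt k : ((rank k).-1 < m)%N.
  by rewrite prednK//; apply: leq_trans (max_card _) _; rewrite card_ord.
pose f k := Ordinal (rank_lt k).
have f_inj : injective f.
  move=> a b /(congr1 val)/= ab; apply: le_anti.
  have := rank_gt0 a; have := rank_gt0 b; rewrite -!leq_rank; lia.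
have -> : [set k | (rank k <= q)%N]%SET = f @^-1: [set i : 'I_m | (i < q)%N]%SET.
  by apply/setP => k; rewrite !inE /=; have := rank_gt0 k; lia.
rewrite card_preimset// -sum1_card.
rewrite (eq_bigl (fun i : 'I_m => (i < q)%N)); last by move=> i; rewrite inE.
by rewrite (big_ord_narrow qm)/= sum1_card card_ord.
Qed.

End TotalOrderRank.

(** * Deleting the lowest colours of every order *)

Section Bottoms.
Variables (r m q : nat) (P : 'I_r -> rel 'I_m).
Hypotheses (hP : preference_order P) (qm : (q <= m)%N).

Let rank i k := #|[set j | P i j k]%SET|.
Let bottom k i := (rank i k <= q)%N.

Lemma sum_bottom i : (\sum_k bottom k i)%N = q.
Proof.
rewrite -[RHS](card_rank_le _ _ (hP i) _ qm) -sum1_card [RHS]big_mkcond/=.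
by apply: eq_bigr => k _; rewrite inE /bottom; case: (_ <= _)%N.
Qed.

Lemma sum_bottoms : (\sum_k \sum_i bottom k i)%N = (r * q)%N.
Proof.
rewrite exchange_big/= (eq_bigr (fun=> q)) => [|i _]; last exact: sum_bottom.
by rewrite sum_nat_const card_ord.
Qed.

(** [w] is the indicator of the colours that remain when the [q] lowest ones of
    each order are deleted. *)
Lemma delete_bottoms : exists w : 'I_m -> nat,
  (m <= \sum_k w k + r * q)%N /\
  forall k, (0 < w k)%N -> forall i, (\sum_(j | P i j k) w j + q <= rank i k)%N.
Proof.
exists (fun k => [forall i, ~~ bottom k i] : nat); split.
  rewrite -sum_bottoms -big_split/= -[leqLHS](card_ord m) -sum1_card.
  apply: leq_sum => k _; case: (boolP [forall i, _]) => //=.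
  by rewrite negb_forall => /existsP[i]; rewrite negbK => bki; rewrite (bigD1 i)//= bki.
move=> k; case: forallP => // nb _ i.
(* A surviving [k] lies above all [q] lowest colours of order [i]; these have weight 0 and account
   for the summand [q]. *)
have qk : (q < rank i k)%N by rewrite ltnNge nb.
rewrite -{1}(sum_bottom i) [X in (_ + X)%N](bigID (fun j => P i j k))/=.
rewrite [X in (_ + (_ + X))%N]big1 ?addn0 => [|j njk]; last first.
  apply/eqP; rewrite eqb0 /bottom; apply: contra njk => jq.
  by rewrite -(leq_rank _ _ (hP i)); apply: leq_trans jq (ltnW qk).
rewrite -big_split/= /rank -sum1_card [leqRHS](eq_bigl (P i ^~ k)); last by move=> j; rewrite inE.
apply: leq_sum => j _; case: forallP => [/(_ i)/negbTE -> //|_].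
by case: bottom.
Qed.

End Bottoms.

(** * A lower bound for [f_inf] and its behaviour to the right of a point *)

Section PreferenceFunction.
Context {R : realType} {r : nat}.
Hypothesis r2 : (2 <= r)%N.
Let r0 : (0 < r)%N := ltnW r2.
Let rR0 : 0 < r%:R :> R. Proof. by rewrite ltr0n. Qed.
Implicit Types (t u v : R).

(** For [t > 0], fewer than [t m] colours are below position [t] in each order. Hence fewer than
    [r t m <= m] colours are below it in some order, and a colour with all positions at least [t]
    remains. *)
Lemma f_inf_ge t : 0 <= t -> t <= r%:R^-1 -> t ^+ r.-1 <= f_inf r t.
Proof.
move=> t0 tr; rewrite leNgt; apply/negP => /f_inf_lt[m [P [m0 hP /f_pref_lt[v0 h]]]].
suff [k tk] : exists k, forall i, t <= rpos R (P i) k.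
  by have := h k tk; rewrite ltNge prod_but_first_max_ge_expr.
apply: contrapT => /forallNP nk.
have mR0 : 0 < m%:R :> R by rewrite ltr0n.
have tpos : 0 < t.
  rewrite lt_neqAle t0 andbT; apply/eqP => te; apply: (nk (Ordinal m0)) => i.
  by rewrite -te; have /andP[] := rpos_itv (R := R) m (P i) (Ordinal m0).
pose rank i k := #|[set j | P i j k]%SET|.
pose q i := (\max_(k | ((rank i k)%:R < t * m%:R)%R) rank i k)%N.
have qt i : (q i)%:R < t * m%:R.
  rewrite /q; elim/big_ind: _ => //; first by rewrite mulr_gt0.
  by move=> a b ha hb; rewrite /maxn; case: ifP.
have qm i : (q i <= m)%N.
  by apply/bigmax_leqP => k _; apply: leq_trans (max_card _) _; rewrite card_ord.
have : (m <= \sum_k \sum_i (rank i k <= q i)%N)%N.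
  rewrite -[leqLHS](card_ord m) -sum1_card; apply: leq_sum => k _.
  have /existsNP[i /negP] := nk k; rewrite -ltNge ltr_pdivrMr// => ik.
  by rewrite (bigD1 i)//= (@leq_bigmax_cond _ _ (rank i) k ik).
rewrite exchange_big/= (eq_bigr q) => [|i _]; last exact: (sum_bottom _ _ _ _ hP (qm i)).
apply/negP; rewrite -ltnNge -(ltr_nat R) natr_sum.
apply: (@lt_le_trans _ _ (\sum_(i < r) t * m%:R)).
  by apply: ltr_sum => //; apply/hasP; exists (Ordinal r0); rewrite ?mem_index_enum.
rewrite sumr_const card_ord -mulrnAl ler_piMl// -mulr_natr.
by rewrite -ler_pdivlMr// mul1r.
Qed.

(** Bernoulli's inequality. *)
Lemma ler_1BnM_expr (x : R) n : 0 <= x <= 1 -> 1 - n%:R * x <= (1 - x) ^+ n.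
Proof.
move=> /andP[x0 x1]; elim: n => [|n IH]; first by rewrite expr0; lra.
rewrite exprS; apply: (@le_trans _ _ ((1 - x) * (1 - n%:R * x))); last first.
  by apply: ler_wpM2l => //; lra.
have : 0 <= n%:R * (x * x) by rewrite !mulr_ge0.
by rewrite -natr1; lra.
Qed.

(** Deleting the lowest [q] of [m] colours in each order sends a position [x] to at
    most [(x - q/m) / (1 - r q/m)].  As [t < 1/r], this pushes positions slightly
    above [t] below [t], while products grow by a factor close to 1. *)
Lemma f_inf_right_lsc t u : 0 <= t -> t < r%:R^-1 -> 0 < u -> u < f_inf r t ->
  exists2 t', t < t' <= r%:R^-1 & u <= f_inf r t'.
Proof.
move=> t0 tr u0 uf; set f := f_inf r t in uf *.
have f0 : 0 < f by lra.
(* Chosen so that [r - 1] factors [1 - e] lower [f] by at most [f - u]. *)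
pose e := (f - u) / (r%:R * f).
have e0 : 0 < e by rewrite divr_gt0 ?mulr_gt0//; lra.
have ef : e * (r%:R * f) = f - u by rewrite /e divfK// gt_eqF// mulr_gt0.
have r1 : 2 <= r%:R :> R by rewrite ler_nat.
have e1 : e < 1.
  rewrite ltr_pdivrMr ?mulr_gt0// mul1r.
  have : f <= r%:R * f by rewrite ler_peMl; lra.
  lra.
have e1u : u <= (1 - e) ^+ r.-1 * f.
  apply: le_trans (_ : (1 - r.-1%:R * e) * f <= _); last first.
    by apply: ler_wpM2r; [lra|apply: ler_1BnM_expr; lra].
  have : r.-1%:R * (e * f) <= r%:R * (e * f).
    by apply: ler_wpM2r; [apply: mulr_ge0; lra|rewrite ler_nat leq_pred].
  lra.
pose t' := t + (r%:R^-1 - t) * (e / 2).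
exists t'.
  have : 0 < (r%:R^-1 - t) * (e / 2) by apply: mulr_gt0; lra.
  have : (r%:R^-1 - t) * (e / 2) <= (r%:R^-1 - t) * 1 by apply: ler_wpM2l; lra.

  rewrite /t'; lra.
rewrite leNgt; apply/negP => ft'.
have y0 : 0 <= 2 * r%:R / e by apply: divr_ge0; lra.

(* A palette this large makes [y = e m / r] at least 2, so that its integer part [q] is at least
   [y / 2]. *)
have [m [P [Nm hP /f_pref_lt[_ hu]]]] :=
  f_inf_lt_large t' u (Num.truncn (2 * r%:R / e)).+1 r0 isT ft'.
have /andP[_ yN] := truncn_itv y0.
have mR : 2 * r%:R / e < m%:R by apply: lt_le_trans yN _; rewrite ler_nat.
have m0 : 0 < m%:R :> R by apply: le_lt_trans mR.
pose y := e * m%:R / r%:R.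
have yr : y * r%:R = e * m%:R by rewrite /y divfK// gt_eqF.
have y2 : 2 <= y.
  by rewrite /y ler_pdivlMr//; move: mR; rewrite ltr_pdivrMr//; lra.
have yp : 0 <= y by lra.
have /andP[qy yq] := truncn_itv yp.
set q := Num.truncn y in qy yq.
have {}yq : y / 2 <= q%:R by move: yq; rewrite -natr1; lra.
have rq : r%:R * q%:R <= e * m%:R by rewrite -yr mulrC ler_wpM2r//; lra.
have qm : (q <= m)%N.
  rewrite -(ler_nat R); have : 2 * q%:R <= r%:R * q%:R :> R by rewrite ler_wpM2r.
  have : e * m%:R < 1 * m%:R by rewrite ltr_pM2r.
  have : 0 <= q%:R :> R by [].
  lra.
have [w [Ww wk]] := delete_bottoms r m q P hP qm.
have WR : m%:R - r%:R * q%:R <= (\sum_k w k)%:R :> R.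
  by rewrite lerBlDr -natrM -natrD ler_nat.
have W1 : m%:R * (1 - e) <= (\sum_k w k)%:R :> R by lra.
have me0 : 0 < m%:R * (1 - e) by rewrite mulr_gt0//; lra.
have W0 : 0 < (\sum_k w k)%:R :> R by lra.
suff : f_inf r t < f by rewrite ltxx.
apply: (f_inf_lt_weighted _ P w _ _ r0 (fun i => (hP i).1.1.2) (fun i => (hP i).2)) => //.
  by rewrite -(ltr0n R).
move=> k wk0 tk.
have Sk i : (\sum_(j | P i j k) w j)%:R + q%:R <= #|[set j | P i j k]%SET|%:R :> R.
  by rewrite -natrD ler_nat wk.
(* Restoring the deleted colours puts at least [q] more below [k]. Since [r t < 1], this raises the
   lower bound [t] on the position by at least [(1/r - t) e / 2]. *)
have t'k i : t' <= rpos R (P i) k.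
  rewrite /rpos ler_pdivlMr//; have := tk i; rewrite /wpos ler_pdivlMr// => tS.
  have : t * (m%:R - r%:R * q%:R) <= t * (\sum_k w k)%:R by rewrite ler_wpM2l.
  have : y / 2 * (1 - r%:R * t) <= q%:R * (1 - r%:R * t).
    by rewrite ler_wpM2r// subr_ge0 mulrC -ler_pdivlMr// mul1r ltW.
  have : y / 2 * (1 - r%:R * t) = (r%:R^-1 - t) * (e / 2) * m%:R.
    have : e * m%:R * t * (r%:R^-1 * r%:R) = e * m%:R * t by rewrite mulVf ?gt_eqF// mulr1.
    by rewrite /y; lra.
  have := Sk i; rewrite /t'; lra.
have /= kk := hu k t'k.
(* The remaining weight is at least [(1 - e) m], so no position grows by more than the factor
   [1 / (1 - e)]. *)
apply: le_lt_trans (_ : (1 - e)^-1 ^+ r.-1 * prod_but_first_max (pref_point R P k) < _); last first.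
  rewrite exprVn mulrC ltr_pdivrMr ?exprn_gt0//; last by lra.
  by apply: lt_le_trans kk _; rewrite mulrC.
rewrite -prod_but_first_maxZ ?invr_ge0//; last 2 first.
- by lra.
- by move=> j; have /andP[] := rpos_itv (R := R) m (P j) k.
apply: ler_prod_but_first_max => // i.
have /andP[-> _] /= := wpos_itv (R := R) _ (P i) w k.
rewrite /wpos /pref_point /rpos mulrCA -invfM [(1 - e) * _]mulrC.
apply: ler_pM => //.
- by have := Sk i; have : 0 <= q%:R :> R by []; lra.
- by rewrite lef_pV2 ?posrE.
Qed.

End PreferenceFunction.

(** * Values of [f_inf] and [beta] *)

Section PreferenceFunctionValues.
Context {R : realType} {r : nat}.
Hypothesis r2 : (2 <= r)%N.
Let r0 : (0 < r)%N := ltnW r2.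
Let rR0 : 0 < r%:R :> R. Proof. by rewrite ltr0n. Qed.
Implicit Types (t u v : R).

Let rV0 : 0 < r%:R^-1 :> R. Proof. by rewrite invr_gt0. Qed.

Let rV1 : r%:R^-1 <= 1 :> R. Proof. by rewrite invf_le1// ler1n. Qed.

(** The witness has [r] colours of weight [q], the [i]-th of which is lowest in
    the [i]-th order, and one colour of weight 1 which is second in every order. *)
Lemma f_inf_lt_family q t v : (0 < q)%N -> 0 < v ->
  (q%:R / (r * q).+1%:R < t) \/ (q%:R / (r * q).+1%:R < v) ->
  (q.+1%:R / (r * q).+1%:R) ^+ r.-1 < v -> f_inf r t < v.
Proof.
move=> q0 v0 bt sv.
pose K := ('I_r + 'I_1)%type.
(* Heights in order [i]: 0 for its own heavy colour, 1 for the light colour, 2 for the other heavy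
   ones. *)
pose sc (i : 'I_r) (a : K) := if a is inl j then (if j == i then 0 else 2)%N else 1%N.
pose le i a b := (sc i a <= sc i b)%N.
pose w (a : K) := if a is inl _ then q else 1%N.
have Wr : (\sum_a w a)%N = (r * q).+1.
  by rewrite big_sumType/= sum_nat_const card_ord big_ord1 addn1.
have w_b i : wpos (R := R) (le i) w (inl i) = q%:R / (r * q).+1%:R.
  rewrite /wpos Wr big_sumType/= (big_pred1 i) ?big_pred0 ?addn0//.
    by move=> j; rewrite /le /= eqxx.
  by move=> j; rewrite /le /= eqxx; case: eqP.
have w_s i s : wpos (R := R) (le i) w (inr s) = q.+1%:R / (r * q).+1%:R.
  rewrite /wpos Wr big_sumType/= (big_pred1 i) ?big_ord1 ?addn1//.
  by move=> j; rewrite /le /=; case: eqP.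
apply: (f_inf_lt_weighted K le w) => //.
- by move=> i b a c; exact: leq_trans.
- by move=> i a b; exact: leq_total.
- by rewrite Wr.
move=> [j|s] _ h.
  (* A heavy colour has position [q / (r q + 1)] in its own order: either this is below the
     threshold, or it bounds the product. *)
  case: bt => [bt|bv]; first by have := h j; rewrite w_b leNgt bt.
  apply: le_lt_trans bv; rewrite -(w_b j).
  exact: (prod_but_first_max_le_coord (fun i => wpos (le i) w (inl j)) j r2
    (fun i => wpos_itv _ _ _ _)).
apply: le_lt_trans sv.
apply: le_trans (prod_but_first_max_le _ (Ordinal r0) _) _.
  by move=> i; rewrite w_s divr_ge0.
by rewrite (eq_bigr (fun=> q.+1%:R / (r * q).+1%:R)) // prodr_const card_neq_ord.
Qed.

(** The constant [3 ^ n] closes the induction: expanding [(1 + x) (1 + 3 ^ n x)] leaves three terms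
    besides 1, each at most [3 ^ n x]. *)
Lemma ler_1DX_expr (x : R) n : 0 <= x <= 1 -> (1 + x) ^+ n <= 1 + 3 ^+ n * x.
Proof.
move=> /andP[x0 x1]; elim: n => [|n IH]; first by rewrite !expr0; lra.
rewrite !exprS; apply: (@le_trans _ _ ((1 + x) * (1 + 3 ^+ n * x))).
  by apply: ler_wpM2l => //; lra.
have p1 : 1 <= 3 ^+ n :> R by rewrite exprn_ege1//; lra.
have : 3 ^+ n * x * x <= 3 ^+ n * x * 1 by apply: ler_wpM2l => //; apply: mulr_ge0; lra.
have : 1 * x <= 3 ^+ n * x by apply: ler_wpM2r.
lra.
Qed.

(** The base is at most [(1 + 1/q) / r], which tends to [1/r] as [q] grows. *)
Lemma family_limit v : r%:R^-1 ^+ r.-1 < v ->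
  exists2 q, (0 < q)%N & (q.+1%:R / (r * q).+1%:R) ^+ r.-1 < v.
Proof.
set n := r.-1; move=> hv.
have z0 : 0 <= 3 ^+ n / (v - r%:R^-1 ^+ n) by rewrite divr_ge0 ?exprn_ge0//; lra.
exists (Num.truncn (3 ^+ n / (v - r%:R^-1 ^+ n))).+1 => //.
set q := (Num.truncn _).+1; have /andP[_] := truncn_itv z0; rewrite -/q => zq.
have q0 : 0 < q%:R :> R by rewrite ltr0n.
have q1 : 0 <= (q%:R^-1 : R) <= 1.
  by rewrite invr_ge0 ltW//= invf_le1// ler1n.
have /andP[q1l q1r] := q1.
apply: le_lt_trans (_ : r%:R^-1 ^+ n * (1 + 3 ^+ n / q%:R) < v).
  apply: le_trans (_ : (r%:R^-1 * (1 + q%:R^-1)) ^+ n <= _); last first.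
    by rewrite exprMn; apply: ler_wpM2l; [rewrite exprn_ge0// invr_ge0 ltW|exact: ler_1DX_expr].
  apply: lerXn2r; [by rewrite nnegrE divr_ge0|
    rewrite nnegrE; apply: mulr_ge0; [exact: ltW|by apply: addr_ge0]|].
  rewrite ler_pdivrMr ?ltr0n//.
  rewrite -[(r * q).+1%:R]natr1 natrM.
  have -> : r%:R^-1 * (1 + q%:R^-1) * (r%:R * q%:R + 1)
    = (q%:R + 1) + r%:R^-1 * (1 + q%:R^-1) :> R.
    rewrite mulrDr mulr1; congr (_ + _).
    rewrite mulrACA mulVf ?gt_eqF// mul1r mulrDl mulVf ?gt_eqF//.
    by rewrite mul1r.
  by rewrite natr1 lerDl; apply: mulr_ge0; [exact: ltW|apply: addr_ge0].
have rn1 : r%:R^-1 ^+ n <= 1 :> R by apply: exprn_ile1 => //; exact: ltW.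
have : 3 ^+ n / q%:R < v - r%:R^-1 ^+ n.
  by move: zq; rewrite ltr_pdivrMr ?subr_gt0// mulrC -ltr_pdivrMr.
have : r%:R^-1 ^+ n * (3 ^+ n / q%:R) <= 1 * (3 ^+ n / q%:R) :> R.
  by apply: ler_wpM2r => //; rewrite divr_ge0 ?exprn_ge0.
lra.
Qed.

Let family_bottom q : q%:R / (r * q).+1%:R < r%:R^-1 :> R.
Proof.
rewrite ltr_pdivrMr ?ltr0n// -natr1 natrM mulrDr mulr1 mulrA mulVf ?gt_eqF// mul1r.
by rewrite ltrDl invr_gt0.
Qed.

(** In the family, heavy colours have product below [1/r] because of their lowest coordinate, and
    the light one has product near [r^-(r-1) <= 1/r]. *)
Lemma f_inf0_le : f_inf r (0 : R) <= r%:R^-1.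
Proof.
rewrite leNgt; apply/negP => h.
have hv : r%:R^-1 ^+ r.-1 < f_inf r (0 : R).
  apply: le_lt_trans h; rewrite -[leRHS]expr1.
  by apply: ler_wiXn2l; [exact: ltW|exact: rV1|rewrite -subn1 subn_gt0].
have [q q0 qv] := family_limit _ hv.
suff : f_inf r 0 < f_inf r (0 : R) by rewrite ltxx.
apply: f_inf_lt_family qv => //; first by apply: lt_trans h.
by right; apply: lt_trans h.
Qed.

(** At threshold [1/r] the heavy colours of the family are excluded, so only the light one
    counts. *)
Lemma f_inf_rV_le : f_inf r (r%:R^-1 : R) <= r%:R^-1 ^+ r.-1.
Proof.
rewrite leNgt; apply/negP => h; have [q q0 qv] := family_limit _ h.
suff : f_inf r r%:R^-1 < f_inf r (r%:R^-1 : R) by rewrite ltxx.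
apply: f_inf_lt_family qv => //; last by left.
by apply: le_lt_trans h; rewrite exprn_ge0// ltW.
Qed.

(** A point with a coordinate below [t] has its product below [t], so lowering
    the threshold from [t] to [0] cannot push the maximum up to [t]. *)
Lemma f_inf_fixpoint : f_inf r (0 : R) <= f_inf r (f_inf r (0 : R)).
Proof.
set t := f_inf r 0; rewrite leNgt; apply/negP.
move=> /f_inf_lt[m [P [m0 hP /f_pref_lt[t0 h]]]].
suff : f_pref P 0 < t by rewrite ltNge f_inf_le.
apply/f_pref_lt; split=> // k _.
have [tk|/existsNP[i /negP]] := pselect (forall i, t <= rpos R (P i) k); first exact: h.
rewrite -ltNge => it; apply: le_lt_trans it.
exact: (prod_but_first_max_le_coord (pref_point R P k) i r2 (fun i => rpos_itv _ _ _)).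
Qed.

(** * The supremum [beta] and the choice of a threshold *)

Section Beta.
Variable a : R.
Hypothesis a0 : a != 0.

Let S := [set t : R | [/\ 0 <= t, t <= r%:R^-1 & t `^ a <= f_inf r t]]%classic.

Let S0 : S 0.
Proof. by split=> //; rewrite powR0// f_inf_ge0. Qed.

Lemma beta_itv : 0 <= beta r a <= r%:R^-1.
Proof.
apply/andP; split; last by apply: ge_sup; [exists 0|move=> t []].
by apply: ub_le_sup => //; exists r%:R^-1 => t [].
Qed.

(** Beyond [beta] the supremum gives [f_inf r t < t ^ a], and [f_inf_right_lsc] carries this back to
    [beta] itself. If [beta = 1/r] there is no such [t], and [f_inf r (1/r) <= r^-(r-1) <= r^-a] is
    used instead. *)
Lemma f_inf_beta_le : 1 <= a <= r.-1%:R -> f_inf r (beta r a) <= beta r a `^ a.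
Proof.
move=> /andP[a1 ar]; have /andP[b0 br] := beta_itv; set b := beta r a in b0 br *.
rewrite leNgt; apply/negP => fb.
have a_gt0 : 0 < a by lra.
have bS t : b < t -> t <= r%:R^-1 -> f_inf r t < t `^ a.
  move=> bt tr; rewrite ltNge; apply/negP => ft.
  suff : t <= b by rewrite leNgt bt.
  apply: ub_le_sup; first by exists r%:R^-1 => s [].
  by split=> //; apply: le_trans b0 (ltW bt).
have [br'|] := ltP b r%:R^-1; last first.
  move=> rb; have be : b = r%:R^-1 by apply/le_anti; rewrite br rb.
  suff : f_inf r b <= b `^ a by rewrite leNgt fb.
  rewrite be; apply: le_trans f_inf_rV_le _.
  rewrite -powR_mulrn; last exact: ltW.
  rewrite -powR_inv1; last exact: ltW.
  rewrite -!powRrM; apply: ler_powR; first by rewrite ler1n.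
  by rewrite !mulN1r lerN2.
pose u := (b `^ a + f_inf r b) / 2.
have bu : b `^ a < u by rewrite /u; lra.
have u0 : 0 < u by apply: le_lt_trans bu; exact: powR_ge0.
have uf : u < f_inf r b by rewrite /u; lra.
have [t' /andP[bt' t'r] ut'] := f_inf_right_lsc r2 b u b0 br' u0 uf.
(* This [t] exceeds [b] and yet has [t ^ a <= u <= f_inf r t]. *)
pose t := Num.min t' (u `^ a^-1).
have uaa : (u `^ a^-1) `^ a = u by rewrite -powRrM mulVf// powRr1// ltW.
have baa : (b `^ a) `^ a^-1 = b by rewrite -powRrM mulfV// powRr1.
have bt : b < t.
  rewrite lt_min bt'/= -baa; apply: gt0_ltr_powR; rewrite ?invr_gt0 ?nnegrE ?powR_ge0//.
  exact: ltW.
have tr : t <= r%:R^-1 by rewrite ge_min t'r.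
suff : t `^ a <= f_inf r t by rewrite leNgt bS.
apply: le_trans (_ : u <= _).
  rewrite -[leRHS]uaa; apply: ge0_ler_powR; rewrite ?nnegrE ?powR_ge0//.
  - exact: ltW.
  - by apply: le_trans b0 (ltW bt).
  - by rewrite ge_min lexx orbT.
by apply: le_trans ut' _; apply: f_inf_anti; rewrite ge_min lexx.
Qed.

End Beta.

Lemma f_inf_beta_itv (a : R) : a != 0 ->
  r%:R^-1 ^+ r.-1 <= f_inf r (beta r a) <= r%:R^-1.
Proof.
move=> a0; have /andP[b0 br] := beta_itv a a0; apply/andP; split.
  by apply: le_trans (f_inf_ge r2 _ (ltW rV0) (lexx _)) _; exact: f_inf_anti.
by apply: le_trans f_inf0_le; exact: f_inf_anti.
Qed.

(** For [a >= 1] the threshold is [beta r a] itself.  For [a < 1] it is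
    [f_inf r 0], which is why [g r a] is constant for [a <= 1]. *)
Lemma beta_threshold (a : R) : 0 < a -> a <= r.-1%:R ->
  exists t, [/\ 0 <= t <= r%:R^-1, f_inf r (beta r a) <= f_inf r t &
    f_inf r (beta r a) <= t `^ Num.max a 1].
Proof.
move=> a0 ar; have an0 : a != 0 by rewrite gt_eqF.
have [a1|a1] := leP 1 a.
  exists (beta r a); split => //; first exact: beta_itv.
  by apply: f_inf_beta_le => //; rewrite a1.
have /andP[b0 _] := beta_itv a an0.
exists (f_inf r 0); split.
- by rewrite f_inf_ge0 f_inf0_le.
- by apply: le_trans f_inf_fixpoint; exact: f_inf_anti.
- by rewrite powRr1 ?f_inf_ge0//; exact: f_inf_anti.
Qed.

End PreferenceFunctionValues.

(** * Random lists *)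

Section RandomLists.
Context {R : realType}.

(** The quotient of binomials is the probability that a random [k]-subset of an [m]-set lies in a
    given [s]-subset. Against [(s/m)^k] it loses at most the factor
    [(1 - k/s)^k >= 1 - k^2/s >= 1/2]. *)
Lemma binomial_ratio_ge (s m k : nat) : (0 < m)%N -> (k <= m)%N -> (2 * k ^ 2 <= s)%N ->
  (s%:R / m%:R) ^+ k / 2 <= 'C(s, k)%:R / 'C(m, k)%:R :> R.
Proof.
move=> m0 km ks.
have sk : ((s - k) ^ k <= s ^_ k)%N.
  rewrite ffact_prod -[X in (_ ^ X)%N](card_ord k) -prod_nat_const.
  by apply: leq_prod => i _; apply: leq_sub2l; exact: ltnW.
have mk : (m ^_ k <= m ^ k)%N.
  rewrite ffact_prod -[X in (_ ^ X)%N](card_ord k) -prod_nat_const.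
  by apply: leq_prod => i _; exact: leq_subr.
have fk0 : 0 < k`!%:R :> R by rewrite ltr0n fact_gt0.
have -> : 'C(s, k)%:R / 'C(m, k)%:R = (s ^_ k)%:R / (m ^_ k)%:R :> R.
  by rewrite -!bin_ffact !natrM -mulf_div divff ?mulr1// gt_eqF.
apply: le_trans (_ : ((s - k) ^ k)%:R / (m ^ k)%:R <= _); last first.
  apply: ler_pM => //; first by rewrite ler_nat.
  by rewrite lef_pV2 ?posrE ?ltr0n ?expn_gt0 ?ffact_gt0 ?m0// ler_nat.
rewrite !natrX expr_div_n mulrAC ler_wpM2r ?invr_ge0 ?exprn_ge0//.
have [k0|k0] := posnP k; first by rewrite k0 !expr0; lra.
have kls : (k <= s)%N by nia.
have s0 : 0 < s%:R :> R by rewrite ltr0n; lia.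
have -> : (s - k)%:R = s%:R * (1 - k%:R / s%:R) :> R.
  by rewrite natrB// mulrBr mulr1 mulrCA divff ?mulr1// gt_eqF.
rewrite exprMn ler_wpM2l ?exprn_ge0//.
have ks2 : 2 * k%:R * k%:R <= s%:R :> R by rewrite -!natrM ler_nat; nia.
have ks1 : 0 <= (k%:R / s%:R : R) <= 1.
  by rewrite divr_ge0//= ler_pdivrMr// mul1r ler_nat.
apply: le_trans (ler_1BnM_expr _ k ks1).
suff : k%:R * (k%:R / s%:R) <= 2^-1 :> R by lra.
by rewrite mulrA ler_pdivrMr//; lra.
Qed.

(** The lists are independent uniform [k]-sets; the union bound is applied to the
    exponential moments [(1/2) ^ count], whose mean is
    [(1 - p/2) ^ #|V j| <= exp (- s j / 2)]. *)
Lemma exists_spread_lists (T C J : finType) (k : nat) (P : pred J)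
    (V : J -> {set T}) (S : J -> {set C}) (s : J -> R) :
  (k <= #|C|)%N ->
  (forall j, P j -> s j <= #|V j|%:R * ('C(#|S j|, k)%:R / 'C(#|C|, k)%:R)) ->
  \sum_(j | P j) expR (- (s j / 4)) < 1 ->
  exists L : T -> {set C}, (forall v, #|L v| = k) /\
    forall j, P j -> s j / 4 <= #|[set v in V j | L v \subset S j]%SET|%:R.
Proof.
move=> kC sV sum1.
pose Q (A : {set C}) := #|A| == k.
pose N : R := 'C(#|C|, k)%:R.
have N0 : 0 < N by rewrite ltr0n bin_gt0.
have cardQ (B : {set C}) : \sum_(A | Q A && (A \subset B)) 1 = 'C(#|B|, k)%:R :> R.
  rewrite sumr_const -cards_draws; congr _%:R; apply: eq_card => A.
  by rewrite !inE andbC.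
have cardN : \sum_(A | Q A) 1 = N :> R.
  rewrite /N -cardsT -cardQ; apply: eq_bigl => A; by rewrite finset.subsetT andbT.
pose cnt j (L : {ffun T -> {set C}}) := #|[set v in V j | L v \subset S j]%SET|.
pose h j v (A : {set C}) : R := if (v \in V j) && (A \subset S j) then 2^-1 else 1.
have hcnt j (L : {ffun T -> {set C}}) : \prod_v h j v (L v) = 2^-1 ^+ cnt j L.
  rewrite /cnt -prodr_const [RHS]big_mkcond/=; apply: eq_bigr => v _.
  by rewrite /h !inE.
have moment j : P j ->
    \sum_(L : {ffun T -> {set C}} | L \in ffun_on Q) 2^-1 ^+ cnt j L
      <= N ^+ #|T| * expR (- (s j / 2)).
  move=> Pj; under eq_bigr do rewrite -hcnt.
  (* Independence of the lists: the sum of products is the product of sums. *)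
  rewrite -(bigA_distr_big Q (h j)).
  pose p : R := 'C(#|S j|, k)%:R / N.
  apply: le_trans (_ : \prod_(v : T) (N * (if v \in V j then expR (- (p / 2)) else 1)) <= _).
    apply: ler_prod => v _; apply/andP; split.
      by apply: sumr_ge0 => A _; rewrite /h; case: ifP => _; lra.
    rewrite /h; case: (boolP (v \in V j)) => vj /=; last by rewrite mulr1 cardN.
    apply: le_trans (_ : N * (1 - p / 2) <= _); last first.
      apply: ler_wpM2l; first exact: ltW.
      by apply: le_trans (expR_ge1Dx _); lra.
    rewrite mulrBr mulr1 mulrA [N * p]mulrC /p divfK ?gt_eqF// -cardN -cardQ.
    rewrite (bigID (fun A : {set C} => A \subset S j))
      [\sum_(A | Q A) 1](bigID (fun A : {set C} => A \subset S j))/=.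
    rewrite (eq_bigr (fun=> 1 * 2^-1)) => [|A /andP[_ ->]]; last by rewrite mul1r.
    rewrite -mulr_suml.
    rewrite [X in _ + X <= _](eq_bigr (fun=> 1)) => [|A /andP[_ /negbTE ->]//].
    lra.
  rewrite big_split/= prodr_const; apply: ler_wpM2l; first by rewrite exprn_ge0// ltW.
  rewrite -big_mkcond/= prodr_const -expRM_natl ler_expR.
  have := sV j Pj; rewrite -/N -/p; lra.
have total : \sum_(L : {ffun T -> {set C}} | L \in ffun_on Q) 1 = N ^+ #|T| :> R.
  transitivity (\sum_(L : {ffun T -> {set C}} | L \in ffun_on Q)
      \prod_(v : T) (fun _ _ => 1 : R) v (L v)).
    by apply: eq_bigr => L _; rewrite big1.
  by rewrite -(bigA_distr_big Q (fun _ _ => 1)) /= cardN prodr_const.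
have halfE : expR (- 1) <= 2^-1 :> R.
  by rewrite expRN lef_pV2 ?posrE ?expR_gt0//; apply: le_trans (expR_ge1Dx _).
(* If every choice of lists failed at some [j], its term [expR (s j / 4) * 2^-1 ^+ cnt j L] would be
   at least 1, because [2^-1 >= 1/e]. The number of choices would then be at most the sum of all
   terms, which is smaller than that number. *)
apply: contrapT => noL.
have : N ^+ #|T| < N ^+ #|T|; last by rewrite ltxx.
apply: le_lt_trans (_ : N ^+ #|T| * \sum_(j | P j) expR (- (s j / 4)) < _); last first.
  by rewrite -[ltRHS]mulr1 ltr_pM2l// exprn_gt0.
rewrite -[leLHS]total.
apply: le_trans (_ : \sum_(L : {ffun T -> {set C}} | L \in ffun_on Q)
    \sum_(j | P j) expR (s j / 4) * 2^-1 ^+ cnt j L <= _).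
  apply: ler_sum => L /ffun_onP LQ.
  have [j Pj jL] : exists2 j, P j & (cnt j L)%:R < s j / 4.
    apply: contrapT => nj; apply: noL; exists L; split.
      by move=> v; exact/eqP/LQ.
    move=> j Pj; rewrite leNgt; apply/negP => jL; apply: nj; exists j => //.
  rewrite (bigD1 j)//= -[leLHS]addr0; apply: lerD; last first.
    by apply: sumr_ge0 => i _; rewrite mulr_ge0 ?expR_ge0 ?exprn_ge0.
  apply: le_trans (_ : expR (s j / 4) * expR (- 1) ^+ cnt j L <= _); last first.
    rewrite ler_wpM2l ?expR_ge0//; apply: lerXn2r => //; rewrite nnegrE ?expR_ge0//.
  rewrite -expRM_natl -expRD -[leLHS]expR0 ler_expR; lra.
rewrite exchange_big/= mulr_sumr; apply: ler_sum => j Pj.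
rewrite -mulr_sumr; apply: le_trans (_ : expR (s j / 4) * (N ^+ #|T| * expR (- (s j / 2))) <= _).
  by rewrite ler_wpM2l ?expR_ge0// moment.
by rewrite mulrCA -expRD; have -> : s j / 4 + - (s j / 2) = - (s j / 4) by lra.
Qed.

End RandomLists.

(** If the colours are ordered in each class by the sizes of their colour
    classes, then the vertices of [V_i] whose lists consist of colours no higher
    than [l] are covered by at most [m] colour classes, none larger than that of [l]. *)
Lemma choosable_independent {R : realType} r n (T : finType) (G : hypergraph r n T)
    (m k : nat) (t : R) :
  (2 <= r)%N -> (0 < m)%N -> (k <= m)%N -> 0 <= t -> (2 * k ^ 2)%:R <= t * m%:R ->
  r%:R * 2 ^+ m * expR (- (n%:R * t ^+ k / 8)) < 1 ->
  0 < f_inf r t -> choosable G k ->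
  exists2 X : {set T}, independent G X &
    (n%:R / (8 * m%:R)) ^+ r.-1 * f_inf r t ^+ k
      <= prod_but_first_max (fun i => #|class_part G X i|%:R : R).
Proof.
move=> r2 m0 km t0 tm small f0 chG; have r0 : (0 < r)%N by apply: ltnW.
have mR : 0 < m%:R :> R by rewrite ltr0n.
pose V (j : 'I_r * {set 'I_m}) := [set v | vclass G v == j.1]%SET.
pose P (j : 'I_r * {set 'I_m}) := t * m%:R <= #|j.2|%:R.
pose s (j : 'I_r * {set 'I_m}) : R := n%:R * ((#|j.2|%:R / m%:R) ^+ k / 2).
have [|||L [Lk Ls]] := @exists_spread_lists R T 'I_m _ k P V snd s _ _.
- by rewrite card_ord.
- move=> j Pj; rewrite /V card_vclass /s ler_wpM2l// card_ord.
  apply: binomial_ratio_ge => //.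
  by rewrite -(ler_nat R); apply: le_trans tm Pj.
- apply: le_lt_trans small.
  apply: le_trans (_ : \sum_(j | P j) expR (- (n%:R * t ^+ k / 8)) <= _).
    apply: ler_sum => j Pj; rewrite ler_expR lerN2.
    have : n%:R * t ^+ k <= n%:R * (#|j.2|%:R / m%:R) ^+ k.
      rewrite ler_wpM2l//; apply: lerXn2r; rewrite ?nnegrE ?divr_ge0//.
      by rewrite ler_pdivlMr.
    rewrite /s; lra.
  rewrite sumr_const -[leLHS]mulr_natl ler_wpM2r ?expR_ge0//.
  rewrite -natrX -natrM ler_nat; apply: leq_trans (max_card _) _.
  by rewrite card_prod card_ord -cardsT -powersetT card_powerset cardsT card_ord.
have [v|c [cL cG]] := chG _ L; first by rewrite Lk.
pose X l := [set v | c v == l]%SET.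
pose le i (j l : 'I_m) := (#|class_part G (X j) i| <= #|class_part G (X l) i|)%N.
have [l [tl fl]] : exists l, (forall i, t <= wpos (le i) (fun=> 1%N) l) /\
    f_inf r t <= prod_but_first_max (fun i => wpos (le i) (fun=> 1%N) l).
  apply: contrapT => nl; have : f_inf r t < f_inf r t; last by rewrite ltxx.
  apply: (f_inf_lt_weighted _ le (fun=> 1%N)) => //.
  - by move=> i b a d; exact: leq_trans.
  - by move=> i a b; exact: leq_total.
  - by rewrite sum_nat_const card_ord muln1.
  by move=> l _ tl; rewrite ltNge; apply/negP => fl; apply: nl; exists l.
exists (X l).
  move=> e eG; apply/negP => /fintype.subsetP eX; apply: (cG e eG); exists l => v /eX.
  by rewrite inE => /eqP.
have wE i : wpos (le i) (fun=> 1%N) l = #|[set j | le i j l]%SET|%:R / m%:R :> R.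
  by rewrite -rpos_wpos.
(* The 8 combines the 2 lost in the binomial ratio with the 4 lost in the spread lists; [m] bounds
   the number of covering colour classes. *)
have large i : n%:R / (8 * m%:R) * wpos (le i) (fun=> 1%N) l ^+ k
    <= #|class_part G (X l) i|%:R :> R.
  have := Ls (i, [set j | le i j l]%SET); rewrite /P /s /= -wE => /(_ _)/wrap[].
    by have := tl i; rewrite wE ler_pdivlMr.
  set x := wpos _ _ _; set A := [set v in _ | _]%SET => xA.
  have : (#|A| <= m * #|class_part G (X l) i|)%N.
    rewrite -sum1_card (partition_big c (mem [set j | le i j l]%SET))/=; last first.
      by move=> v; rewrite !inE => /andP[_ /fintype.subsetP/(_ _ (cL v))]; rewrite inE.
    rewrite -[m in leqRHS]card_ord -sum_nat_const big_mkcond/=; apply: leq_sum => j _.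
    case: ifP => //; rewrite inE => jl; apply: leq_trans jl.
    rewrite sum1_card; apply/subset_leq_card/fintype.subsetP => v.
    by rewrite !inE => /andP[+ ->]; rewrite /A !inE => /andP[-> _].
  rewrite -(ler_nat R) natrM => /(le_trans xA) {}xA.
  by rewrite mulrAC ler_pdivrMr ?mulr_gt0// -/x; lra.
have [i ->] := prod_but_first_max_ex (fun i => #|class_part G (X l) i|%:R : R) r0.
have x0 j : 0 <= wpos (R := R) (le j) (fun=> 1%N) l.
  by have /andP[] := wpos_itv (R := R) _ (le j) (fun=> 1%N) l.
apply: le_trans (_ : \prod_(j | j != i) (n%:R / (8 * m%:R) * wpos (le j) (fun=> 1%N) l ^+ k) <= _).
  rewrite big_split/= prodr_const card_neq_ord prodrXl ler_wpM2l ?exprn_ge0 ?divr_ge0 ?mulr_ge0//.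
  apply: lerXn2r; rewrite ?nnegrE ?prodr_ge0 ?(ltW f0)//.
  exact: le_trans fl (prod_but_first_max_le _ i x0).
apply: ler_prod => j _; rewrite large andbT.
by rewrite mulr_ge0 ?exprn_ge0 ?divr_ge0 ?mulr_ge0.
Qed.

(** * The lower bound *)

Section Asymptotics.
Context {R : realType}.

Lemma half_le_ln2 : 2^-1 <= ln 2 :> R.
Proof.
have : ln (1 + (- 2^-1)) <= - 2^-1 :> R by apply: le_ln1Dx; lra.
have -> : 1 + - 2^-1 = 2^-1 :> R by lra.
by rewrite lnV ?posrE//; lra.
Qed.

Lemma ln_ge_half r : (2 <= r)%N -> 2^-1 <= ln r%:R :> R.
Proof.
move=> r2; apply: le_trans half_le_ln2 _.
by rewrite ler_ln ?posrE ?ltr0n ?ler_nat// (leq_trans _ r2).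
Qed.

(** Take logarithms and multiply by [a]: the right side becomes at least [l - c k >= 3 r ln l], and
    the left side at most [(r - 1) (ln 24 + 3 ln l)], which is smaller as [r ln 24 < ln l]. *)
Lemma expected_spread_ge (r n k : nat) (l a t c : R) : (2 <= r)%N -> (0 < n)%N ->
  24 ^+ r < l -> 1 <= a <= r.-1%:R -> l <= a * ln n%:R -> 0 < t ->
  - c <= a * ln t -> c * k%:R <= l - 3 * r%:R * ln l ->
  24 * l ^+ 3 <= n%:R * t ^+ k.
Proof.
move=> r2 n0 lr /andP[a1 ar] ln_n t0 ct ck.
have nR : 0 < n%:R :> R by rewrite ltr0n.
have l0 : 0 < l by apply: le_lt_trans lr; rewrite exprn_ge0.
have y0 : 0 < n%:R * t ^+ k by rewrite mulr_gt0// exprn_gt0.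
have z0 : 0 < 24 * l ^+ 3 by rewrite mulr_gt0// exprn_gt0.
have ln24 : 0 <= ln 24 :> R by rewrite ln_ge0//; lra.
have lnl : r%:R * ln 24 < ln l.
  rewrite mulr_natl -lnXn// ltr_ln ?posrE// exprn_gt0//; lra.
have lnl0 : 0 <= ln l by apply: le_trans (ltW lnl); rewrite mulr_ge0.
have r1E : r.-1%:R = r%:R - 1 :> R by rewrite -subn1 natrB// ltnW.
have E1 : ln (n%:R * t ^+ k) = ln n%:R + k%:R * ln t.
  by rewrite lnM ?posrE ?exprn_gt0// lnXn// mulr_natl.
have E2 : ln (24 * l ^+ 3) = ln 24 + 3 * ln l.
  by rewrite lnM ?posrE ?exprn_gt0// lnXn// mulr_natl.
rewrite leNgt -ltr_ln ?posrE// E1 E2; apply/negP => h.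
have h1 : a * (ln n%:R + k%:R * ln t) < a * (ln 24 + 3 * ln l) by rewrite ltr_pM2l; lra.
have h2 : a * (ln 24 + 3 * ln l) <= r.-1%:R * (ln 24 + 3 * ln l).
  by apply: ler_wpM2r => //; rewrite addr_ge0// mulr_ge0.
have h3 : k%:R * - c <= k%:R * (a * ln t) by apply: ler_wpM2l.
rewrite r1E in h2; lra.
Qed.

Lemma union_bound_lt1 (r m : nat) (y : R) : m%:R + r%:R < y ->
  r%:R * 2 ^+ m * expR (- y) < 1.
Proof.
move=> mry; apply: le_lt_trans (_ : expR (r%:R + m%:R - y) < 1); last first.
  by rewrite expR_lt1; lra.
rewrite !expRD ler_wpM2r ?expR_ge0//; apply: ler_pM; rewrite ?exprn_ge0//.
  by apply: le_trans (expR_ge1Dx _); lra.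
rewrite -[m%:R]mulr1 expRM_natl; apply: lerXn2r; rewrite ?nnegrE ?expR_ge0//.
by apply: le_trans (expR_ge1Dx _).
Qed.

End Asymptotics.

Theorem theorem4p4 (R : realType) (r : nat) (hr : (2 <= r)%N) :
  exists d2 : R,
    forall (n : nat) (T : finType) (G : hypergraph r n T) (d : R),
      1 <= d -> d <= n%:R ^+ r.-1 ->
      d2 < d ->
      propertyI G d ->
      g r (logb n%:R d) * logb r%:R d - 6 * r%:R * ln (ln d)
        < (list_chromatic_number G)%:R.
Proof.
(* The term [24 ^+ r] absorbs the numerical constants; [8 * r%:R ^+ r] gives [phi * l >= 8], as
   [phi >= r^-(r-1)]. *)
exists (expR (24 ^+ r + 8 * r%:R ^+ r)) => n T G d d1 dn d2d GI.
have r0 : (0 < r)%N by apply: ltnW.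
have rR : 2 <= r%:R :> R by rewrite ler_nat.
have le_expr (x : R) j : 1 <= x -> (0 < j)%N -> x <= x ^+ j.
  by move=> x1 j0; apply: ler_eXnr.
have rr : r%:R <= r%:R ^+ r :> R by apply: le_expr => //; lra.
have p24 : 24 <= 24 ^+ r :> R by apply: le_expr => //; lra.
have d0 : 0 < d by lra.
have [l lE] : exists l, l = ln d by exists (ln d).
rewrite -lE.
have lM : 24 ^+ r + 8 * r%:R ^+ r < l.
  by rewrite lE -[ltLHS]expRK ltr_ln ?posrE ?expR_gt0.
have l1 : 40 < l by lra.
have l0 : 0 < l by lra.
have lnl0 : 0 <= ln l by rewrite ln_ge0//; lra.
have n2 : (2 <= n)%N.
  rewrite ltnNge; apply/negP => n1.
  have : d <= 1 by apply: le_trans dn _; rewrite exprn_ile1// lern1.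
  by move=> /ln_le0; rewrite -lE; lra.
have nR : 0 < n%:R :> R by rewrite ltr0n ltnW.
have lnn0 : 0 < ln n%:R :> R by apply: lt_le_trans (ln_ge_half n n2).
have lnr : 2^-1 <= ln r%:R :> R := ln_ge_half r hr.
have [a aE] : exists a, a = logb n%:R d by exists (logb n%:R d).
rewrite -aE.
have aln : a * ln n%:R = l by rewrite aE /logb -lE divfK// gt_eqF.
have a0 : 0 < a by rewrite aE /logb -lE divr_gt0.
have ar : a <= r.-1%:R.
  rewrite aE /logb ler_pdivrMr//.
  have -> : r.-1%:R * ln n%:R = ln (n%:R ^+ r.-1) :> R by rewrite lnXn// mulr_natl.
  by rewrite ler_ln ?posrE// exprn_gt0.
have [phi phiE] : exists phi, phi = f_inf r (beta r a) by exists (f_inf r (beta r a)).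
have /andP[phil phiu] : r%:R^-1 ^+ r.-1 <= phi <= r%:R^-1.
  by rewrite phiE; apply: f_inf_beta_itv; rewrite ?gt_eqF.
have rV : 0 < r%:R^-1 :> R by rewrite invr_gt0; lra.
have phi0 : 0 < phi by apply: lt_le_trans phil; rewrite exprn_gt0.
(* With this [c] the main term of the bound is [l / c]. *)
have [c cE] : exists c, c = - ln phi by exists (- ln phi).
have cr : ln r%:R <= c.
  by rewrite cE lerNr -lnV ?posrE ?ler_ln ?posrE//; lra.
have c_gt0 : 0 < c by lra.
have gE : g r a * logb r%:R d = l / c.
  rewrite /g gt_eqF// /g_pos -phiE /logb -lE.
  have -> : ln phi = - c by rewrite cE opprK.
  rewrite [- c / _]mulNr invrN mulrNN mul1r invf_div mulrC mulrA divfK// gt_eqF//.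
  by lra.
rewrite ltNge; apply/negP; have chk := (list_chromatic_numberP G hr).1.
move: (list_chromatic_number G) chk => k chk kle.
(* Multiplication by [c >= ln r >= 1/2] keeps at least half of the error term [6 r ln l]. *)
have ck : c * k%:R <= l - 3 * r%:R * ln l.
  have : c * k%:R <= c * (l / c - 6 * r%:R * ln l).
    by rewrite ler_wpM2l -?gE// ltW.
  rewrite mulrBr [c * (l / c)]mulrC divfK ?gt_eqF//.
  have : 2^-1 * (6 * r%:R * ln l) <= c * (6 * r%:R * ln l).
    by rewrite ler_wpM2r ?mulr_ge0//; lra.
  lra.
have k2l : k%:R <= 2 * l.
  have : 2^-1 * k%:R <= c * k%:R by rewrite ler_wpM2r//; lra.
  have : 0 <= 3 * r%:R * ln l by rewrite !mulr_ge0.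
  lra.
have [t [/andP[t0 tr] ft pt]] := beta_threshold hr a a0 ar.
rewrite -phiE in ft pt.
have a'1 : 1 <= Num.max a 1 by rewrite le_max lexx orbT.
have a'a : a <= Num.max a 1 by rewrite le_max lexx.
have a'r : Num.max a 1 <= r.-1%:R by rewrite ge_max ar ler1n -ltnS prednK.
move: (Num.max a 1) pt a'1 a'a a'r => a' pt a'1 a'a a'r.
have t_gt0 : 0 < t.
  rewrite lt_neqAle t0 andbT; apply/eqP => t0E.
  by move: pt; rewrite -t0E powR0 ?leNgt ?phi0// gt_eqF//; lra.
have lnt : - c <= a' * ln t.
  by rewrite cE opprK -ln_powR ler_ln ?posrE ?powR_gt0.
have t1 : t <= 1 by apply: le_trans tr _; rewrite invf_le1//; lra.
have phit : phi <= t.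
  rewrite -ler_ln ?posrE//.
  have : (a' - 1) * ln t <= 0 by rewrite mulr_ge0_le0 ?ln_le0//; lra.
  by move: lnt; rewrite cE; lra.
have y24 : 24 * l ^+ 3 <= n%:R * t ^+ k.
  apply: (@expected_spread_ge _ r n k l a' t c hr (ltnW n2)) => //.
  - by lra.
  - by rewrite a'1.
  - by rewrite -aln ler_wpM2r// ltW.
have l30 : 0 <= l ^+ 3 by rewrite exprn_ge0// ltW.
(* The palette has just over [l ^ 3] colours: enough for [2 k^2 <= t m], where [k <= 2 l], and few
   enough for [m + r < 3 l^3 <= n t^k / 8]. *)
have [m [m0 lm m1]] : exists m, [/\ (0 < m)%N, l ^+ 3 < m%:R & m%:R <= l ^+ 3 + 1].
  have /andP[ml lm] := truncn_itv l30; exists (Num.truncn (l ^+ 3)).+1.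
  by split=> //; rewrite -natr1 lerD2r.
have lX : l <= l ^+ 3 by apply: le_expr => //; lra.
have rl : r%:R <= l by lra.
have l3E : l ^+ 3 = l * l * l by rewrite !exprS expr0 mulr1 mulrA.
have lsq : 40 * l <= l * l by apply: ler_wpM2r; lra.
have lcub : 40 * (l * l) <= l * (l * l) by apply: ler_wpM2r; [apply: mulr_ge0; exact: ltW|lra].
have km : (k <= m)%N by rewrite -(ler_nat R); lra.
have phil8 : 8 <= phi * l.
  have rpow : r%:R^-1 ^+ r.-1 * r%:R ^+ r = r%:R :> R.
    by rewrite -[X in _ * _ ^+ X](prednK r0) exprSr mulrA -exprMn mulVf ?expr1n
      ?mul1r// gt_eqF//; lra.
  have : r%:R^-1 ^+ r.-1 * (8 * r%:R ^+ r) <= phi * l.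
    by apply: ler_pM => //; lra.
  lra.
have ktm : (2 * k ^ 2)%:R <= t * m%:R :> R.
  have kk : k%:R * k%:R <= (2 * l) * (2 * l) by apply: ler_pM.
  have tl : phi * l ^+ 3 <= t * m%:R by apply: ler_pM => //; exact: ltW.
  have : 8 * (l * l) <= phi * l * (l * l) by apply: ler_wpM2r; [apply: mulr_ge0; lra|].
  rewrite natrM natrX expr2; lra.
have small : r%:R * 2 ^+ m * expR (- (n%:R * t ^+ k / 8)) < 1 by apply: union_bound_lt1; lra.
have f0 : 0 < f_inf r t by apply: lt_le_trans ft.
have [X Xind] := choosable_independent _ n T G m k t hr m0 km t0 ktm small f0 chk.
move=> /le_lt_trans/(_ (GI X Xind)); rewrite -lE; apply/negP; rewrite -leNgt.
have mR : 0 < m%:R :> R by rewrite ltr0n.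
(* The bound [ck], exponentiated. *)
have dphi : l ^+ (3 * r) <= d * phi ^+ k.
  have -> : l ^+ (3 * r) = expR (3 * r%:R * ln l).
    by rewrite -natrM expRM_natl lnK.
  have -> : d * phi ^+ k = expR (l - c * k%:R).
    by rewrite expRD lE lnK ?posrE// -mulNr expRM_natr cE opprK lnK.
  by rewrite ler_expR; lra.
apply: le_trans (_ : (n%:R / (8 * m%:R)) ^+ r.-1 * phi ^+ k <= _); last first.
  rewrite ler_wpM2l ?exprn_ge0 ?divr_ge0 ?mulr_ge0//.
  by apply: lerXn2r; rewrite ?nnegrE// ltW.
have m8 : 0 < (8 * m%:R) ^+ r.-1 :> R by rewrite exprn_gt0// mulr_gt0.
rewrite expr_div_n -!mulrA ler_wpM2l ?exprn_ge0//.
rewrite ler_pdivrMl// mulrCA ler_pdivlMl//; apply: le_trans dphi.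
(* As [8 m <= 16 l ^ 3], it remains to see that [16 ^ (r - 1) <= l]. *)
apply: le_trans (_ : (16 * l ^+ 3) ^+ r.-1 * l ^+ 2 <= _).
  rewrite ler_wpM2r ?exprn_ge0//; first exact: ltW.
  by apply: lerXn2r; rewrite ?nnegrE ?mulr_ge0//; lra.
have -> : l ^+ (3 * r) = l * (l ^+ 3) ^+ r.-1 * l ^+ 2.
  by rewrite exprM -[X in _ ^+ X = _](prednK r0) exprSr [_ ^+ 3 in X in _ * X]exprS mulrCA mulrA.
rewrite ler_wpM2r ?exprn_ge0//; first exact: ltW.
rewrite exprMn; apply: ler_wpM2r; first by rewrite !exprn_ge0// ltW.
apply: le_trans (_ : 24 ^+ r <= _); last lra.
apply: le_trans (_ : 24 ^+ r.-1 <= _).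
  by apply: lerXn2r; rewrite ?nnegrE//; lra.
by rewrite ler_eXn2l ?leq_pred//; lra.
Qed.
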